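(* There is a universal constant $K>0$ such that the following holds. Let $L$ be a list with induced discrete distribution $F$, and assume the Markov chain induced by $\mathrm{DNF}$ and $F$ possesses a unique stationary distribution $\pi_F$. Then \[ \left|\mathbb{E}_\sigma[\mathrm{DNF}(\sigma(L))]-N(L)\cdot\pi_F(c)\right|\le K\cdot N(L)^{2/3}, \] where $c$ is the closed state.
   Context: Bin covering: a list $L=(a_1,\ldots,a_N)$ of item sizes in $[0,1]$, $N(L)=N$; a bin is covered if its total size is at least $1$. Dual Next-Fit ($\mathrm{DNF}$) processes items in order, putting every item into a single current bin; as soon as the current bin has total size at least $1$ it is counted as covered and a new empty current bin is started; $\mathrm{DNF}(L)$ is the number of covered bins. $\sigma(L)$ is $L$ permuted by a uniformly random permutation $\sigma$ of its positions. A discrete distribution $F$ is given by non-negative rational item sizes and positive rational probabilities summing to $1$. The distribution induced by $L$ has as sizes exactly the distinct values in $L$, each value $v$ having probability $|\{j:a_j=v\}|/N$. The Markov chain induced by $\mathrm{DNF}$ and $F$: its states are the bin levels in $(0,1)$ that can arise when $\mathrm{DNF}$ packs items with sizes in the support of $F$, together with a special closed state $c$ representing level $0$ and all levels $\ge1$; from a state with level $\ell$ ($\ell=0$ for $c$) one draws $X\sim F$ and moves to level $\ell+X$ if $\ell+X<1$ and to $c$ otherwise.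
   Formalization: It is assumed that no item of L has size 0. With zero-size items the claim fails: for L=(0,...,0) the chain has only the state c, so π_F(c)=1, while DNF covers no bin, and N ≤ K·N^{2/3} is false for large N. *)

(* Defs.v *)
From HB Require Import structures.
From mathcomp Require Import all_boot all_order all_algebra all_fingroup.
From mathcomp Require Import finmap.
From mathcomp Require Import boolp classical_sets functions cardinality.
From mathcomp Require Import reals exp.

Set Implicit Arguments.
Unset Strict Implicit.
Unset Printing Implicit Defensive.

Import Order.TTheory GRing.Theory Num.Theory.
Local Open Scope ring_scope.

(** * Dual Next-Fit *)

Definition next_level (l a : rat) : rat := if l + a < 1 then l + a else 0.

Fixpoint DNF_from (l : rat) (s : seq rat) : nat :=
  if s is a :: s' then ((1 <= l + a)%R + DNF_from (next_level l a) s')%N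
  else 0%N.

Definition DNF (s : seq rat) : nat := DNF_from 0 s.

Definition DNF_level (s : seq rat) : rat := foldl next_level 0 s.

Definition permute (L : seq rat) (s : 'S_(size L)) : seq rat :=
  [seq L`_(s i) | i <- enum 'I_(size L)].

Definition expected_DNF (R : realType) (L : seq rat) : R :=
  (\sum_(s : 'S_(size L)) (DNF (permute s))%:R) / #|'S_(size L)|%:R.

(** * Discrete distributions *)

Record ddist := DDist {
  sizes : seq rat;
  prob : rat -> rat; (* only its values on [sizes] matter *)
  sizes_uniq : uniq sizes;
  sizes_ge0 : forall v, v \in sizes -> 0 <= v;
  prob_gt0 : forall v, v \in sizes -> 0 < prob v;
  prob_sum1 : \sum_(v <- sizes) prob v = 1 }.

Definition induced (L : seq rat) (F : ddist) : Prop :=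
  sizes F =i L /\
  forall v, v \in sizes F -> prob F v = (count_mem v L)%:R / (size L)%:R.

(** * The Markov chain induced by DNF and a discrete distribution *)

Definition reachable_level (F : ddist) : set rat :=
  [set l | 0 < l < 1 /\
           exists2 s : seq rat, {subset s <= sizes F} & DNF_level s = l]%classic.

Lemma reachable_level_finite (F : ddist) : finite_set (reachable_level F).
Proof.
pose D : rat := \prod_(v <- sizes F) (denq v)%:~R.
have D_gt0 : 0 < D by apply: prodr_gt0 => v _; rewrite ltr0z denq_gt0.
have size_int v : v \in sizes F -> v * D \is a Num.int.
  move=> vF; rewrite /D (big_rem v) //= mulrA -{1}(divq_num_den v).
  rewrite divfK ?intr_eq0 ?denq_neq0 //.
  by apply: rpredM; [|apply: rpred_prod => w _]; apply: intr_int.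
have foldl_int s l : {subset s <= sizes F} -> l * D \is a Num.int ->
    foldl next_level l s * D \is a Num.int.
  elim: s l => //= a s IHs l sF lD; apply: IHs.
    by move=> b bs; apply: sF; rewrite inE bs orbT.
  rewrite /next_level; case: ifP => _; last by rewrite mul0r rpred0.
  by rewrite mulrDl rpredD // size_int // sF // inE eqxx.
pose m := Num.truncn D.
apply: (@sub_finite_set _ _ ((fun k : nat => k%:R / D) @` `I_m.+1)%classic);
  last exact/finite_image/finite_II.
move=> l [/andP[l_gt0 l_lt1] [s sF sl]].
have: l * D \is a Num.int by rewrite -sl; apply: foldl_int; rewrite ?mul0r.
have lD_ge0 : 0 <= l * D by rewrite mulr_ge0 ?ltW.
rewrite intrEge0 // => /natrP[k kE].
exists k; last by rewrite -kE mulfK ?gt_eqF.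
by rewrite /= ltnS truncn_ge_nat ?(ltW D_gt0) // -kE ger_pMl // ltW.
Qed.

Definition levels (F : ddist) : {fset rat} := fset_set (reachable_level F).

Lemma levelsP (F : ddist) (l : rat) : l \in levels F <-> reachable_level F l.
Proof. by rewrite in_fset_set ?inE //; apply: reachable_level_finite. Qed.

(* [None] is the closed state c. *)
Definition state (F : ddist) : finType := option (levels F).

Definition closed_state (F : ddist) : state F := None.

Definition level_of (F : ddist) (x : state F) : rat :=
  if x is Some l then val l else 0.

Lemma level_of_inj (F : ddist) : injective (@level_of F).
Proof.
have gt0 (l : levels F) : val l != 0.
  by have /levelsP[/andP[/lt0r_neq0 ? _] _] := valP l.
case=> [l|] [l'|] //= => [/val_inj->//|/eqP|/esym/eqP].
  by rewrite (negPf (gt0 l)).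
by rewrite (negPf (gt0 l')).
Qed.

Lemma level_of_surj (F : ddist) (x : state F) (v : rat) : v \in sizes F ->
  exists y : state F, level_of y = next_level (level_of x) v.
Proof.
move=> vF; case: (eqVneq (next_level (level_of x) v) 0) => [->|nz].
  by exists (closed_state F).
have [s sF sx] : exists2 s : seq rat,
    {subset s <= sizes F} & DNF_level s = level_of x.
  case: x {nz} => [l|]; last by exists [::].
  by have /levelsP[_] := valP l.
have lx : next_level (level_of x) v \in levels F.
  apply/levelsP; split; last first.
    exists (rcons s v); first by move=> w; rewrite mem_rcons inE => /predU1P[->|/sF].
    by rewrite /DNF_level foldl_rcons -/(DNF_level s) sx.
  have x_ge0 : 0 <= level_of x.
    case: x {nz sx} => [l|] //=.
    by have /levelsP[/andP[/ltW]] := valP l.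
  move: nz; rewrite /next_level; case: ifP => [lt1 nz|]; last by rewrite eqxx.
  by rewrite lt1 andbT lt0r nz addr_ge0 //; exact: (sizes_ge0 vF).
by exists (Some [` lx]%fset).
Qed.

(* States are determined by their levels.  A draw of size 0 in state c leads
   back to c although no bin gets covered, so the stationary mass of c is the
   covering rate only if all sizes are positive. *)
Definition transition (R : realType) (F : ddist) (x y : state F) : R :=
  \sum_(v <- sizes F | level_of y == next_level (level_of x) v) ratr (prob F v).

Lemma transition_sum1 (R : realType) (F : ddist) (x : state F) :
  \sum_y transition R x y = 1.
Proof.
rewrite /transition (exchange_big_dep predT) //=.
rewrite -(rmorph1 (@ratr R)) -(prob_sum1 F) rmorph_sum /=.
apply: eq_big_seq => v vF; have [y yE] := level_of_surj x vF.
rewrite (big_pred1 y) // => z; rewrite -yE; exact: (inj_eq (@level_of_inj F)).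
Qed.

Definition stationary (R : realType) (F : ddist) (pi : {ffun state F -> R}) :
    Prop :=
  [/\ forall x, 0 <= pi x,
      \sum_x pi x = 1 &
      forall y, \sum_x pi x * transition R x y = pi y].

(* Main.v *)
(* Let h l be the expected number of i.i.d. draws from F that close a bin of
   level l.  Then pi(c) * h 0 = 1, and for i.i.d. items
   h 0 * #covered - h (level) + h 0 - #items is a martingale.  For a random
   permutation of L, exchanging the next item with a later one shows that the
   k-th step of a window changes the mean of this quantity by at most
   h 0 * k / N, since 0 <= h <= h 0.  Hence a window of n <= sqrt N items that
   starts with an empty bin covers n * pi(c) + O(1) bins on average.  Emptying
   the bin before each of the O(sqrt N) windows loses at most one bin per
   window, so the total error is even O(sqrt N). *)

Require Import Defs.
From mathcomp Require Import all_boot all_order all_algebra.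
From mathcomp Require Import all_fingroup finmap ring lra zify.
From mathcomp Require Import reals exp.

Import Order.TTheory GRing.Theory Num.Theory.
Local Open Scope ring_scope.

(** * Dependence of DNF on the starting level *)

Lemma DNF_from_cat (l : rat) (u v : seq rat) :
  DNF_from l (u ++ v) = (DNF_from l u + DNF_from (foldl next_level l u) v)%N.
Proof. by elim: u l => //= a u IHu l; rewrite IHu addnA. Qed.

Lemma next_level_range (l a : rat) : 0 <= l -> 0 <= a -> 0 <= next_level l a < 1.
Proof. by rewrite /next_level; case: ltP => //= *; rewrite ?addr_ge0. Qed.

Lemma foldl_next_level_range (l : rat) (s : seq rat) :
  0 <= l < 1 -> {in s, forall a, 0 <= a} -> 0 <= foldl next_level l s < 1.
Proof.
elim: s l => //= a s IHs l /andP[l0 l1] s0; apply: IHs => [|b bs].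
  by apply: next_level_range => //; apply: s0; rewrite mem_head.
by apply: s0; rewrite inE bs orbT.
Qed.

(** If both bins close on the same item, the runs merge. If only the fuller one closes, its run is
    one bin ahead but restarts at level 0, so the induction hypothesis applies with the roles
    exchanged. *)
Lemma DNF_from_mono (l l' : rat) (s : seq rat) :
  {in s, forall a, 0 <= a} -> 0 <= l -> l <= l' ->
  (DNF_from l s <= DNF_from l' s <= (DNF_from l s).+1)%N.
Proof.
elim: s l l' => //= a s IHs l l' s0 l0 ll'.
have a0 : 0 <= a by apply: s0; rewrite mem_head.
have {}s0 : {in s, forall b, 0 <= b} by move=> b bs; apply: s0; rewrite inE bs orbT.
rewrite /next_level !(leNgt 1).
have [l'a|l'a] := ltP (l' + a) 1.
  have la : l + a < 1 by apply: le_lt_trans l'a; rewrite lerD2r.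
  by rewrite la !add0n IHs ?addr_ge0 ?lerD2r.
have [la|la] := ltP (l + a) 1.
  have /andP[le1 le2] := IHs 0 (l + a) s0 (lexx _) (addr_ge0 l0 a0).
  by rewrite add0n add1n le2 ltnS le1.
by rewrite leqnn /= leqnSn.
Qed.

(** This is the price of emptying the bin at a cut: the level left by [u] changes the count on [v]
    by at most one. *)
Lemma DNF_cat_bound (u v : seq rat) :
  {in u ++ v, forall a, 0 <= a} ->
  (DNF u + DNF v <= DNF (u ++ v) <= (DNF u + DNF v).+1)%N.
Proof.
move=> uv0; rewrite /DNF DNF_from_cat -addnS !leq_add2l.
apply: DNF_from_mono => //.
  by move=> a av; apply: uv0; rewrite mem_cat av orbT.
have u0 : {in u, forall a, 0 <= a} by move=> a au; apply: uv0; rewrite mem_cat au.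
by have /andP[] := foldl_next_level_range 0 u isT u0.
Qed.

(** All sizes are at least some [d > 0], so a bin closes after boundedly many draws and a truncated
    recursion already solves the first-step equations exactly. *)
Lemma closing_time (R : realType) (L : seq rat) :
  {in L, forall a, 0 < a} ->
  exists h : rat -> R,
    [/\ forall l, 1 <= l -> h l = 0,
        forall l, 0 <= l < 1 -> h l = 1 + (\sum_(a <- L) h (l + a)) / (size L)%:R,
        forall l, 0 <= h l &
        {homo h : x y / x <= y >-> y <= x}].
Proof.
move=> L0.
(* [h k l] is the expected closing time truncated at [k]. *)
pose h := fix h (k : nat) (l : rat) {struct k} : R := if k is k'.+1 then
  if l < 1 then 1 + (\sum_(a <- L) h k' (l + a)) / (size L)%:R else 0 else 0.
have [d d0 dL] : exists2 d : rat, 0 < d & {in L, forall a, d <= a}.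
  elim: L L0 {h} => [|a L IHL] L0; first by exists 1.
  have [|d d0 dL] := IHL; first by move=> b bL; apply: L0; rewrite inE bL orbT.
  exists (Num.min a d); first by rewrite lt_min d0 L0 ?mem_head.
  by move=> b; rewrite inE ge_min => /predU1P[->|/dL->]; rewrite ?lexx ?orbT.
have h_ge0 k l : 0 <= h k l.
  elim: k l => //= k IHk l; case: ifP => // _.
  by rewrite addr_ge0 // divr_ge0 // sumr_ge0.
have h_mono k x y : x <= y -> h k y <= h k x.
  elim: k x y => //= k IHk x y xy; case: ifPn => [y1|_]; last exact: (h_ge0 k.+1).
  rewrite (le_lt_trans xy y1) lerD2l ler_wpM2r ?invr_ge0 //.
  by apply: ler_sum => a _; apply: IHk; rewrite lerD2r.
(* From such a level, [k] draws of size at least [d] surely close the bin. *)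
have h_stable k l : 1 <= l + k%:R * d -> h k.+1 l = h k l.
  elim: k l => [|k IHk] l; first by rewrite mul0r addr0 /= leNgt => /negbTE->.
  move=> lk; rewrite [LHS]/= [RHS]/=; case: ifP => // _; congr (1 + _ / _).
  apply: eq_big_seq => a /dL da; apply: IHk; apply: le_trans lk _.
  by rewrite -natr1; lra.
have [k kd] : exists k, 1 <= k%:R * d.
  exists (Num.bound d^-1); rewrite -ler_pdivrMr // mul1r ltW //.
  by apply: archi_boundP; rewrite invr_ge0 ltW.
exists (h k); split=> //.
- by case: k {kd} => //= k l; rewrite leNgt => /negbTE->.
- move=> l /andP[l0 l1]; rewrite -h_stable /= ?l1 //; lra.
- exact: h_mono.
Qed.

(** For [j] outside [A], composing with the transposition of [t] and [j] keeps [f s] and swaps [s t]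
    with [s j], so both have the same total. Only the [j] in [A] contribute, each at most [M] per
    permutation. *)
Lemma exchange_bound (R : realType) (N : nat) (t : 'I_N) (A : {set 'I_N})
    (f : 'S_N -> 'I_N -> R) (M : R) :
  t \notin A ->
  (forall s i, 0 <= f s i <= M) ->
  (forall s s' : 'S_N, {in A, s =1 s'} -> f s =1 f s') ->
  `|N%:R * (\sum_s f s (s t)) - \sum_s \sum_i f s i|
    <= #|A|%:R * M * #|'S_N|%:R.
Proof.
move=> tA fM fA.
have -> : \sum_s \sum_i f s i = \sum_(j < N) \sum_(s : 'S_N) f s (s j).
  rewrite [RHS]exchange_big; apply: eq_bigr => s _.
  by rewrite (reindex_inj (@perm_inj _ s)).
have -> : N%:R * (\sum_(s : 'S_N) f s (s t)) = \sum_(j < N) \sum_(s : 'S_N) f s (s t).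
  by rewrite sumr_const card_ord mulr_natl.
rewrite -sumrB (bigID (mem A)) /= [X in _ + X]big1 ?addr0; last first.
  move=> j jA; apply/eqP; rewrite subr_eq0 eq_sym; apply/eqP.
  rewrite (reindex_inj (mulgI (tperm t j))); apply: eq_bigr => s _.
  rewrite permM tpermR; apply: fA => i iA; rewrite permM tpermD //.
    by apply: contraNneq tA => ->.
  by apply: contraNneq jA => ->.
apply: le_trans (ler_norm_sum _ _ _) _.
rewrite -mulrA mulr_natl -sumr_const; apply: ler_sum => j _.
rewrite -sumrB; apply: le_trans (ler_norm_sum _ _ _) _.
rewrite mulr_natr -[leRHS]sumr_const; apply: ler_sum => s _.
have := fM s (s t); have := fM s (s j); rewrite ler_norml; lra.
Qed.

(** * Windows of a random permutation *)

Lemma DNF_rcons (s : seq rat) (a : rat) :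
  DNF (rcons s a) = (DNF s + (1 <= DNF_level s + a)%R)%N.
Proof. by rewrite -cats1 /DNF DNF_from_cat /= addn0. Qed.

Lemma DNF_level_rcons (s : seq rat) (a : rat) :
  DNF_level (rcons s a) = next_level (DNF_level s) a.
Proof. by rewrite /DNF_level foldl_rcons. Qed.

Lemma window_mem (N b k : nat) (i : 'I_N) :
  i \in take k (drop b (enum 'I_N)) -> (b <= i < b + k)%N.
Proof.
move=> /(map_f val); rewrite map_take map_drop val_enum_ord drop_iota take_iota.
rewrite mem_iota add0n => /andP[-> /leq_trans]; apply.
by rewrite leq_add2l geq_minl.
Qed.

Lemma eq_window (L : seq rat) (b k : nat) (s s' : 'S_(size L)) :
  {in [set i : 'I_(size L) | b <= i < b + k]%N, s =1 s'} ->
  take k (drop b (permute s)) = take k (drop b (permute s')).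
Proof.
move=> ss'.
have wE (s0 : 'S_(size L)) : take k (drop b (permute s0)) =
    [seq L`_(s0 i) | i <- take k (drop b (enum 'I_(size L)))].
  by rewrite map_take map_drop.
rewrite !wE; apply/eq_in_map => i iw; have iA := window_mem _ _ _ _ iw.
by rewrite ss' // inE.
Qed.

Lemma card_window (N b k : nat) : (#|[set i : 'I_N | b <= i < b + k]| <= k)%N.
Proof.
rewrite cardE -(size_map val) -[leqRHS](size_iota b); apply: uniq_leq_size.
  by rewrite map_inj_uniq ?enum_uniq //; apply: val_inj.
by move=> _ /mapP[i + ->]; rewrite mem_enum inE mem_iota.
Qed.

Lemma size_permute (L : seq rat) (s : 'S_(size L)) : size (permute s) = size L.
Proof. by rewrite size_map size_enum_ord. Qed.

Lemma nth_permute (L : seq rat) (s : 'S_(size L)) (t : 'I_(size L)) :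
  (permute s)`_t = L`_(s t).
Proof. by rewrite (nth_map t) ?size_enum_ord // nth_ord_enum. Qed.

Lemma permute_sub (L : seq rat) (s : 'S_(size L)) : {subset permute s <= L}.
Proof. by move=> a /mapP[i _ ->]; apply: mem_nth. Qed.

(** The step errors [j / N] add up to at most [k ^ 2 / N], where [N] is the length of [L]; the
    summand 1 pays for the level at the end of the window. *)
Lemma window_DNF (R : realType) (L : seq rat) (h : rat -> R) (b k : nat) :
  {in L, forall a, 0 < a} ->
  (forall l, 1 <= l -> h l = 0) ->
  (forall l, 0 <= l < 1 -> h l = 1 + (\sum_(a <- L) h (l + a)) / (size L)%:R) ->
  (forall l, 0 <= h l) ->
  {homo h : x y / x <= y >-> y <= x} ->
  (b + k <= size L)%N ->
  `|\sum_(s : 'S_(size L)) (h 0 * (DNF (take k (drop b (permute s))))%:R - k%:R)|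
    <= (k%:R ^+ 2 / (size L)%:R + 1) * (h 0 * #|'S_(size L)|%:R).
Proof.
move=> L0 h1 hE h_ge0 h_mono bkL.
pose w j (s : 'S_(size L)) := take j (drop b (permute s)).
have lw j s : 0 <= DNF_level (w j s) < 1.
  apply: foldl_next_level_range => // a /mem_take/mem_drop/permute_sub/L0.
  exact: ltW.
have hw j s : 0 <= h (DNF_level (w j s)) <= h 0.
  by rewrite h_ge0 h_mono //; case/andP: (lw j s).
(* The near-martingale, equal to 0 at the start of the window. *)
pose G j s := h 0 * (DNF (w j s))%:R - h (DNF_level (w j s)) + h 0 - j%:R.
suff GE j : (b + j <= size L)%N ->
    `|\sum_s G j s| <= j%:R ^+ 2 / (size L)%:R * (h 0 * #|'S_(size L)|%:R).
  have -> : \sum_(s : 'S_(size L)) (h 0 * (DNF (take k (drop b (permute s))))%:R - k%:R) =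
      \sum_s G k s + \sum_s (h (DNF_level (w k s)) - h 0).
    by rewrite -big_split; apply: eq_bigr => s _; rewrite /G /w /=; ring.
  apply: le_trans (ler_normD _ _) _; rewrite mulrDl lerD ?GE // mul1r.
  apply: le_trans (ler_norm_sum _ _ _) _.
  rewrite mulr_natr -[leRHS]sumr_const; apply: ler_sum => s _.
  have := hw k s; rewrite ler_norml; lra.
elim: j => [_|j IHj bjL].
  rewrite big1 ?normr0 ?expr0n ?mul0r // => s _.
  by rewrite /G /w take0 /DNF /DNF_level /=; ring.
rewrite addnS in bjL; pose t := Ordinal bjL.
have N_gt0 : 0 < (size L)%:R :> R by rewrite ltr0n (leq_trans _ bjL).
have wS s : w j.+1 s = rcons (w j s) (L`_(s t)).
  rewrite /w (take_nth 0) ?nth_drop ?(nth_permute L s t) //.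
  by rewrite size_drop size_permute ltn_subRL.
pose f (s : 'S_(size L)) (i : 'I_(size L)) := h (DNF_level (w j s) + L`_i).
have Lge0 (i : 'I_(size L)) : 0 <= L`_i by rewrite ltW // L0 // mem_nth.
have f_range s i : 0 <= f s i <= h 0.
  by rewrite /f h_ge0 h_mono // addr_ge0 //; case/andP: (lw j s).
have sum_f s : \sum_i f s i = (size L)%:R * (h (DNF_level (w j s)) - 1).
  rewrite (hE _ (lw j s)) (big_nth 0) big_mkord addrAC subrr add0r.
  by rewrite mulrC divfK // gt_eqF.
(* When the item closes the bin, the gain [h 0] in the count cancels the return to level 0, and
   [f s (s t)] vanishes. *)
have GS s : G j.+1 s = G j s + (h (DNF_level (w j s)) - 1 - f s (s t)).
  rewrite /G wS DNF_rcons DNF_level_rcons natrD /f /next_level -natr1.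
  case: ltP => [_|la] /=; first by ring.
  by rewrite (h1 _ la); ring.
under eq_bigr do rewrite GS.
rewrite big_split /=.
apply: le_trans (ler_normD _ _) _.
have step : `|\sum_s (h (DNF_level (w j s)) - 1 - f s (s t))|
    <= j%:R / (size L)%:R * (h 0 * #|'S_(size L)|%:R).
  have tA : t \notin [set i : 'I_(size L) | b <= i < b + j]%N.
    by rewrite inE ltnn andbF.
  have := exchange_bound _ _ t _ f (h 0) tA f_range.
  under [X in _ - X]eq_bigr do rewrite sum_f.
  rewrite -mulr_sumr -mulrBr normrM.
  rewrite (gtr0_norm N_gt0) distrC -sumrB => fA.
  rewrite mulrAC ler_pdivlMr // mulrC; apply: le_trans (fA _) _.
    by move=> s s' ss' i; rewrite /f /w (eq_window _ _ _ _ _ ss').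
  by rewrite -mulrA ler_wpM2r ?mulr_ge0 // ler_nat card_window.
apply: le_trans (lerD (IHj (ltnW bjL)) step) _.
(* What remains is [j ^ 2 + j <= (j + 1) ^ 2]. *)
rewrite -mulrDl ler_wpM2r ?mulr_ge0 // -mulrDl ler_wpM2r ?invr_ge0 ?ltW //.
by rewrite -natr1; have := ler0n R j; lra.
Qed.

(** Peeling off one block at a time costs [c] for the window estimate and 1 for the cut. *)
Lemma blocks_DNF (R : realType) (L : seq rat) (p c : R) (n q b : nat) :
  {in L, forall a, 0 < a} ->
  (forall b' k, (k <= n)%N -> (b' + k <= size L)%N ->
    `|\sum_(s : 'S_(size L)) ((DNF (take k (drop b' (permute s))))%:R - k%:R * p)|
      <= c * #|'S_(size L)|%:R) ->
  (b <= size L <= b + q * n)%N ->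
  `|\sum_(s : 'S_(size L)) ((DNF (drop b (permute s)))%:R - (size L - b)%:R * p)|
    <= q%:R * (c + 1) * #|'S_(size L)|%:R.
Proof.
move=> L0 winE; elim: q b => [|q IHq] b /andP[bL Lq].
  rewrite mul0n addn0 in Lq.
  rewrite !mul0r big1 ?normr0 // => s _.
  by rewrite drop_oversize ?size_permute // (eqP Lq) mul0r subrr.
(* The last block may be shorter than [n], or empty. *)
set k := minn n (size L - b).
have bkL : (b + k <= size L)%N by rewrite -leq_subRL // geq_minr.
have kn : (k <= n)%N by apply: geq_minl.
have kq : (size L <= b + k + q * n)%N.
  by move: Lq; rewrite /k mulSn; lia.
have {}IHq := IHq (b + k)%N; rewrite bkL in IHq.
pose T (s : 'S_(size L)) := take k (drop b (permute s)).
pose D (s : 'S_(size L)) := drop (b + k) (permute s).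
have split_drop s : drop b (permute s) = T s ++ D s.
  by rewrite /D addnC -drop_drop cat_take_drop.
have sizeE : (size L - b)%:R = k%:R + (size L - (b + k))%:R :> R.
  by rewrite -natrD subnDA subnKC // geq_minr.
have -> : \sum_(s : 'S_(size L)) ((DNF (drop b (permute s)))%:R - (size L - b)%:R * p) =
  \sum_s ((DNF (T s))%:R - k%:R * p) +
  \sum_s ((DNF (D s))%:R - (size L - (b + k))%:R * p) +
  \sum_s ((DNF (drop b (permute s)))%:R - ((DNF (T s))%:R + (DNF (D s))%:R)).
  by rewrite -!big_split; apply: eq_bigr => s _; rewrite sizeE /=; ring.
have -> : q.+1%:R * (c + 1) * #|'S_(size L)|%:R =
    c * #|'S_(size L)|%:R + q%:R * (c + 1) * #|'S_(size L)|%:R + #|'S_(size L)|%:R :> R.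
  by rewrite -natr1; ring.
apply: le_trans (ler_normD _ _) _; apply: lerD.
  apply: le_trans (ler_normD _ _) _; apply: lerD; last exact: IHq.
  exact: winE.
apply: le_trans (ler_norm_sum _ _ _) _.
rewrite -[leRHS]sumr_const; apply: ler_sum => s _.
have := DNF_cat_bound (T s) (D s); rewrite -split_drop => /(_ _)/andP[].
  by move=> a /mem_drop/permute_sub/L0/ltW.
rewrite -(ler_nat R) -[X in _ -> is_true X -> _](ler_nat R) -natr1 natrD ler_norml.
lra.
Qed.

(** * Closing time and the stationary distribution *)

Lemma sum_sizes (R : realType) (L : seq rat) (F : ddist) (f : rat -> R) :
  induced L F ->
  \sum_(v <- sizes F) ratr (prob F v) * f v = (\sum_(a <- L) f a) / (size L)%:R.
Proof.
move=> [sL pL].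
have -> : \sum_(v <- sizes F) ratr (prob F v) * f v =
    (\sum_(v <- sizes F) f v *+ count_mem v L) / (size L)%:R.
  rewrite mulr_suml; apply: eq_big_seq => v vF.
  by rewrite pL // fmorph_div !rmorph_nat -mulr_natl; ring.
have sF : perm_eq (sizes F) (undup L).
  by apply: uniq_perm; rewrite ?sizes_uniq ?undup_uniq // => v; rewrite sL mem_undup.
by rewrite (perm_big _ sF) /= -[in RHS](big_undup_iterop_count _ L).
Qed.

(** One step from [x] lowers the expected remaining time by 1. Averaged over [pi], this loss is
    balanced by the restarts at [c], each adding [h 0]. *)
Lemma stationary_closed (R : realType) (L : seq rat) (F : ddist)
    (pi : {ffun state F -> R}) (h : rat -> R) :
  induced L F -> {in L, forall a, 0 < a} ->
  (forall l, 1 <= l -> h l = 0) ->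
  (forall l, 0 <= l < 1 -> h l = 1 + (\sum_(a <- L) h (l + a)) / (size L)%:R) ->
  stationary pi -> pi (closed_state F) * h 0 = 1.
Proof.
move=> indF L0 h1 hE [pi0 pi1 piP].
(* Arriving at [c] ends the wait, hence the value 0 there, whereas a departure from [c] counts
   [h 0]. *)
pose g (x : state F) := if x is Some _ then h (level_of x) else 0.
have lx (x : state F) : 0 <= level_of x < 1.
  by case: x => [l|] //=; have /levelsP[/andP[/ltW-> ->]] := valP l.
have Pg x : \sum_y transition R x y * g y = h (level_of x) - 1.
  rewrite hE // addrAC subrr add0r -(sum_sizes _ _ _ _ indF).
  under eq_bigr do rewrite /transition mulr_suml.
  rewrite (exchange_big_dep predT) //=; apply: eq_big_seq => v vF.
  have [y yE] := level_of_surj x vF; rewrite (big_pred1 y); last first.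
    by move=> z; rewrite -yE; apply: (inj_eq (@level_of_inj F)).
  congr (_ * _); move: yE; rewrite /next_level; case: ltP => xv.
    case: y => [l|] /= yE; first by rewrite yE.
    (* A positive draw that leaves the bin open cannot lead to level 0, so the target is not [c]. *)
    have v0 : 0 < v by rewrite L0 // -indF.1.
    have /andP[lx0 _] := lx x.
    by have := ltr_wpDl lx0 v0; rewrite -yE ltxx.
  rewrite h1 //; case: y => [l|] //= l0; have /levelsP[/andP[+ _] _] := valP l.
  by rewrite [\val l]l0 ltxx.
have gE x : h (level_of x) = g x + (x == closed_state F)%:R * h 0.
  by case: x => [l|] /=; rewrite ?mul0r ?addr0 // mul1r add0r.
have : \sum_x pi x * (h (level_of x) - 1) = \sum_x pi x * g x.
  under eq_bigr do rewrite -Pg mulr_sumr.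
  rewrite exchange_big; apply: eq_bigr => y _.
  by under eq_bigr do rewrite mulrA; rewrite -mulr_suml piP.
under eq_bigr do rewrite gE mulrBr mulr1 mulrDr.
have -> : pi (closed_state F) * h 0 = \sum_x pi x * ((x == closed_state F)%:R * h 0).
  rewrite (bigD1 (closed_state F)) // eqxx mul1r big1 => [|x /negbTE->].
    exact/esym/addr0.
  by rewrite mul0r mulr0.
rewrite sumrB pi1 big_split /=; lra.
Qed.

(** * Choice of the window length *)

Lemma nat_sqrt_bounds (N : nat) : exists n, (n ^ 2 <= N < n.+1 ^ 2)%N.
Proof.
elim: N => [|N [n /andP[nN Nn]]]; first by exists 0%N.
have [lt|ge] := ltnP N.+1 (n.+1 ^ 2); first by exists n; rewrite leqW.
by exists n.+1; rewrite ge /= (leq_ltn_trans Nn) // ltn_sqr.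
Qed.

Theorem theorem2 (R : realType) :
  exists2 K : R, 0 < K &
    forall (L : seq rat) (F : ddist) (piF : {ffun state F -> R}),
      (forall a, a \in L -> 0 <= a <= 1) ->
      0 \notin L ->
      induced L F ->
      unique (@stationary R F) piF ->
      `| expected_DNF R L - (size L)%:R * piF (closed_state F) |
        <= K * (size L)%:R `^ (2 / 3).
Proof.
(* With [n] the integer square root of the length, [n + 2] blocks cost [2 + 1] each, and
   [3 * (n + 2) <= 9 * n] since [n >= 1]. *)
exists 9 => // L F piF L01 L0 indF [statF _].
have {L01 L0}L_gt0 : {in L, forall a, 0 < a}.
  move=> a aL; have /andP[a0 _] := L01 a aL; rewrite lt0r a0 andbT.
  by apply: contraNneq L0 => <-.
(* Probabilities summing to 1 need a nonempty support. *)
have N_gt0 : (0 < size L)%N.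
  case: L indF {L_gt0} => // -[sF _]; have := prob_sum1 F.
  case: (sizes F) sF => [_|v s /(_ v)]; last by rewrite mem_head.
  by rewrite big_nil => /esym/eqP; rewrite oner_eq0.
have [h [h1 hE h_ge0 h_mono]] := closing_time R L L_gt0.
have ph := stationary_closed _ _ _ _ _ indF L_gt0 h1 hE statF.
set p := piF _ in ph *.
have h0_gt0 : 0 < h 0 by rewrite hE // ltr_pwDl // divr_ge0 // sumr_ge0.
have [n /andP[n2N Nn2]] := nat_sqrt_bounds (size L).
have n_gt0 : (0 < n)%N by case: n n2N Nn2 => // _; rewrite ltnNge N_gt0.
(* The constant 2 comes from [k ^ 2 <= n ^ 2 <= size L]; scaling by [h 0] turns [k * p] into [k], as
   [p * h 0 = 1]. *)
have win b' k : (k <= n)%N -> (b' + k <= size L)%N ->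
    `|\sum_(s : 'S_(size L)) ((DNF (take k (drop b' (permute s))))%:R - k%:R * p)|
      <= 2 * #|'S_(size L)|%:R.
  move=> kn bkL; rewrite -(ler_pM2l h0_gt0) -[X in X * _ <= _](gtr0_norm h0_gt0).
  rewrite -normrM mulr_sumr.
  rewrite (eq_bigr (fun s : 'S_(size L) =>
    h 0 * (DNF (take k (drop b' (permute s))))%:R - k%:R)); last first.
    by move=> s _; rewrite mulrBr mulrCA [h 0 * p]mulrC ph mulr1.
  apply: le_trans (window_DNF _ _ _ _ _ L_gt0 h1 hE h_ge0 h_mono bkL) _.
  rewrite [leRHS]mulrCA ler_wpM2r ?mulr_ge0 //.
  rewrite (_ : 2 = 1 + 1) // lerD2r ler_pdivrMr ?ltr0n // mul1r -natrX ler_nat.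
  by apply: leq_trans n2N; rewrite leq_sqr.
(* A length below [(n + 1) ^ 2] is at most [n * (n + 2)]. *)
have cover : (0 <= size L <= 0 + n.+2 * n)%N.
  by rewrite leq0n add0n -ltnS (leq_trans Nn2) // expnS expn1; nia.
have S_gt0 : 0 < #|'S_(size L)|%:R :> R.
  by rewrite ltr0n; apply/card_gt0P; exists 1%g; rewrite inE.
have := blocks_DNF _ _ _ _ _ _ _ L_gt0 win cover.
rewrite sumrB sumr_const subn0.
rewrite -[X in _ - X]mulr_natr.
under eq_bigr do rewrite drop0.
rewrite -(ler_pM2r (_ : 0 < #|'S_(size L)|%:R^-1)) ?invr_gt0 // mulfK ?gt_eqF //.
rewrite -[X in _ * X <= _](gtr0_norm (_ : 0 < #|'S_(size L)|%:R^-1)) ?invr_gt0 //.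
rewrite -normrM mulrBl mulfK ?gt_eqF // -/(expected_DNF R L) => /le_trans; apply.
(* Since the length is at least 1, the exponent 1/2 may be raised to 2/3. *)
have nN : n%:R <= (size L)%:R `^ (2 / 3) :> R.
  apply: (@le_trans _ _ ((size L)%:R `^ (2^-1))).
    rewrite powR12_sqrt // -[leLHS]ger0_norm // -sqrtr_sqr ler_wsqrtr //.
    by rewrite -natrX ler_nat.
  by apply: ler_powR; [rewrite ler1n | lra].
have : 1 <= n%:R :> R by rewrite ler1n.
rewrite -addn2 natrD; lra.
Qed.
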